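(* For every non-maximal conflict clique $\sigma_1\in\Sigma$ there is a conflict clique $\sigma_2\in\Sigma$ with $\sigma_1\subset\sigma_2$ (strict inclusion) such that, over the polyhedron $\mathcal{L}$, the clique conflict cuts referring to $\sigma_1$ are dominated by those referring to $\sigma_2$; that is, every point $(\bar x,\bar y,\bar f,\bar\varphi)\in\mathcal{L}$ that violates at least one clique conflict cut referring to $\sigma_1$ also violates at least one clique conflict cut referring to $\sigma_2$.
   Context: STOP instance: a tuple $\langle G,S,P,s,t,p,d,M,T\rangle$ where $G=(N,A)$ is a finite (not necessarily complete) digraph; $s,t\in N$, $s\neq t$; $S,P\subseteq N\setminus\{s,t\}$ with $N=S\cup P\cup\{s,t\}$ and $S\cap P=\emptyset$; $p_i\in\mathbb{Z}^+$ for $i\in P$; $d_{ij}>0$ for each arc $(i,j)\in A$; $M$ is a finite set of identical vehicles, $m=|M|$; $T$ is the time limit of each route. Notation: for $V\subset N$, $\delta^+(V)=\{(i,j)\in A: i\in V, j\in N\setminus V\}$ and $\delta^-(V)=\{(i,j)\in A: i\in N\setminus V, j\in V\}$; for $i\in N$, $\delta^+(i)=\{j\in N:(i,j)\in A\}$ and $\delta^-(i)=\{j\in N:(j,i)\in A\}$. $R_{ij}$ is the minimum total traverse time of a path from $i$ to $j$ in $G$ ($R_{ii}=0$; $R_{ij}=\infty$ if no path exists; a constraint below involving an infinite $R$-value is read as forcing the corresponding $x_{ij}$, and $f_{ij}$ in the case of an upper bound on $f_{ij}$, to be $0$). The polyhedron $\mathcal{L}$ (feasible region of the linear relaxation of the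 STOP formulation) is the set of real vectors $(x,y,f,\varphi)\in\mathbb{R}^{A}\times\mathbb{R}^{N}\times\mathbb{R}^{A}\times\mathbb{R}$ satisfying: - $y_i=1$ for all $i\in S\cup\{s,t\}$; - $\sum_{j\in\delta^+(i)}x_{ij}=y_i$ for all $i\in S\cup P$; - $\sum_{j\in\delta^+(s)}x_{sj}=\sum_{i\in\delta^-(t)}x_{it}=m-\varphi$; - $\sum_{i\in\delta^-(s)}x_{is}=\sum_{j\in\delta^+(t)}x_{tj}=0$; - $\sum_{j\in\delta^+(i)}x_{ij}-\sum_{j\in\delta^-(i)}x_{ji}=0$ for all $i\in S\cup P$; - $f_{sj}=(T-d_{sj})x_{sj}$ for all $j\in\delta^+(s)$; - $\sum_{j\in\delta^-(i)}f_{ji}-\sum_{j\in\delta^+(i)}f_{ij}=\sum_{j\in\delta^+(i)}d_{ij}x_{ij}$ for all $i\in S\cup P$; - $f_{ij}\leq(T-R_{si}-d_{ij})x_{ij}$ for all $(i,j)\in A$ with $i\neq s$; - $f_{ij}\geq R_{jt}x_{ij}$ for all $(i,j)\in A$; - $0\leq x_{ij}\leq1$ and $f_{ij}\geq0$ for all $(i,j)\in A$; $0\leq y_i\leq1$ for all $i\in N$; $0\leq\varphi\leq m$. Conflict cliques: $\mathcal{K}$ is the set of unordered pairs $\{i,j\}$ of distinct vertices of $N\setminus\{s,t\}$ such that every route (directed path in $G$ from $s$ to $t$) visiting both $i$ and $j$, in any order, has total traverse time exceeding $T$. The conflict graph is the undirected graph $G_c=(N\setminus\{s,t\},\mathcal{K})$,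 and $\Sigma$ is the set of all cliques of $G_c$ (including single vertices). A clique is maximal if it is not properly contained in another clique of $G_c$. Clique conflict cuts (CCCs) referring to $\sigma\in\Sigma$: the inequalities $$\sum_{e\in\delta^-(V)}x_e\geq\sum_{i\in\sigma}y_i\quad\text{for all }V\subseteq N\setminus\{s\}\text{ with }\sigma\subseteq V,$$ $$\sum_{e\in\delta^+(V)}x_e\geq\sum_{i\in\sigma}y_i\quad\text{for all }V\subseteq N\setminus\{t\}\text{ with }\sigma\subseteq V.$$ *)

(* Defs.v *)
From mathcomp Require Import all_boot all_order all_algebra.
From mathcomp Require Import reals constructive_ereal.

Set Implicit Arguments.
Unset Strict Implicit.
Unset Printing Implicit Defensive.

Import Order.TTheory GRing.Theory Num.Theory.
Local Open Scope ring_scope.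

(* Only the values of [prize] on [profit] and of [dur] on [arcs] matter. *)
Record stop_instance (R : realType) := StopInstance {
  node : finType;
  arcs : {set node * node};
  mandatory : {set node};
  profit : {set node};
  source : node;
  target : node;
  prize : node -> nat;
  dur : node -> node -> R;
  vehicle : finType;
  limit : R;
  source_neq_target : source != target;
  mandatory_sub : mandatory \subset ~: [set source; target];
  profit_sub : profit \subset ~: [set source; target];
  node_cover : mandatory :|: profit :|: [set source; target] = setT;
  mandatory_profit_disj : [disjoint mandatory & profit];
  prize_gt0 : forall i, i \in profit -> (0 < prize i)%N;
  dur_gt0 : forall i j, (i, j) \in arcs -> 0 < dur i j
}.

Section Stop.
Context {R : realType} (I : stop_instance R).

Local Notation N := (node I).
Local Notation s := (source I).
Local Notation t := (target I).
Local Notation T := (limit I).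

(* Vectors of R^A are finite functions on this type. *)
Definition diarc := {e : N * N | e \in arcs I}.

Definition src (a : diarc) : N := (val a).1.
Definition tgt (a : diarc) : N := (val a).2.
Definition adur (a : diarc) : R := dur (src a) (tgt a).

Definition cut_out (V : {set N}) : {set diarc} :=
  [set a : diarc | (src a \in V) && (tgt a \notin V)].
Definition cut_in (V : {set N}) : {set diarc} :=
  [set a : diarc | (src a \notin V) && (tgt a \in V)].

(* Paths are simple; [p] lists the vertices after the start [i]. *)
Definition dipath (i j : N) (p : seq N) : bool :=
  [&& path (fun u v => (u, v) \in arcs I) i p, last i p == j & uniq (i :: p)].

Definition path_time (i : N) (p : seq N) : R :=
  \sum_(e <- zip (i :: p) p) dur e.1 e.2.

(* The minimum ranges over all simple paths: these have at most [#|N|]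
   vertices. It is [+oo] if there is no path. *)
Definition min_time (i j : N) : \bar R :=
  \big[Order.min/+oo%E]_(p : {bseq #|N| of N} | dipath i j p)
    (path_time i p)%:E.

Record in_polyhedron (x : {ffun diarc -> R}) (y : {ffun N -> R})
    (f : {ffun diarc -> R}) (phi : R) : Prop := InPolyhedron {
  mandatory_visited :
    forall i, i \in mandatory I :|: [set s; t] -> y i = 1;
  out_degree : forall i, i \in mandatory I :|: profit I ->
    \sum_(a | src a == i) x a = y i;
  source_out : \sum_(a | src a == s) x a = #|vehicle I|%:R - phi;
  target_in : \sum_(a | tgt a == t) x a = #|vehicle I|%:R - phi;
  source_in : \sum_(a | tgt a == s) x a = 0;
  target_out : \sum_(a | src a == t) x a = 0;
  balance : forall i, i \in mandatory I :|: profit I ->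
    \sum_(a | src a == i) x a - \sum_(a | tgt a == i) x a = 0;
  flow_source : forall a, src a = s -> f a = (T - adur a) * x a;
  flow_balance : forall i, i \in mandatory I :|: profit I ->
    \sum_(a | tgt a == i) f a - \sum_(a | src a == i) f a
      = \sum_(a | src a == i) adur a * x a;
  flow_upper : forall a, src a != s ->
    if min_time s (src a) == +oo%E then x a = 0 /\ f a = 0
    else f a <= (T - fine (min_time s (src a)) - adur a) * x a;
  flow_lower : forall a,
    if min_time (tgt a) t == +oo%E then x a = 0
    else fine (min_time (tgt a) t) * x a <= f a;
  x_bounds : forall a, 0 <= x a <= 1;
  f_ge0 : forall a, 0 <= f a;
  y_bounds : forall i, 0 <= y i <= 1;
  phi_bounds : 0 <= phi <= #|vehicle I|%:R
}.

(* The edges of the conflict graph. *)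
Definition conflict (i j : N) : Prop :=
  [/\ i != j, i \notin [set s; t], j \notin [set s; t] &
      forall p, dipath s t p -> i \in s :: p -> j \in s :: p ->
        T < path_time s p].

Definition conflict_clique (sigma : {set N}) : Prop :=
  sigma \subset ~: [set s; t] /\
  (forall i j, i \in sigma -> j \in sigma -> i != j -> conflict i j).

Definition maximal_clique (sigma : {set N}) : Prop :=
  conflict_clique sigma /\
  ~ (exists tau : {set N}, conflict_clique tau /\ sigma \proper tau).

Definition ccc_in (x : {ffun diarc -> R}) (y : {ffun N -> R})
    (sigma V : {set N}) : Prop :=
  \sum_(a in cut_in V) x a >= \sum_(i in sigma) y i.

Definition ccc_out (x : {ffun diarc -> R}) (y : {ffun N -> R})
    (sigma V : {set N}) : Prop :=
  \sum_(a in cut_out V) x a >= \sum_(i in sigma) y i.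

Definition violates_ccc (x : {ffun diarc -> R}) (y : {ffun N -> R})
    (sigma : {set N}) : Prop :=
  (exists V : {set N},
     [/\ V \subset ~: [set s], sigma \subset V & ~ ccc_in x y sigma V]) \/
  (exists V : {set N},
     [/\ V \subset ~: [set t], sigma \subset V & ~ ccc_out x y sigma V]).

End Stop.

(* Main.v *)
(* Given a clique tau strictly containing sigma and a violated cut of sigma on V,
   the cut of tau on V :|: tau is violated: enlarging V only adds arcs entering
   (resp. leaving) vertices of tau :\: V, whose total x-value is at most
   y(tau :\: V), while the right-hand side grows by at least y(tau :\: V)
   because sigma is contained in V. *)
Require Import Defs.
From mathcomp Require Import all_boot all_order all_algebra.
From mathcomp Require Import boolp reals.

Set Implicit Arguments.
Unset Strict Implicit.
Unset Printing Implicit Defensive.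

Import Order.TTheory GRing.Theory Num.Theory.
Local Open Scope ring_scope.

(** Grouping arcs by their [h]-endpoint turns the [y]-weight of [W] into the [x]-weight of the arcs
    with [h a \in W]. Taking [h] to be [tgt] or [src] serves entering and leaving cuts alike. *)
Lemma cut_sum_le (R : realDomainType) (A N : finType) (h : A -> N)
    (D E : {set A}) (W : {set N}) (x : A -> R) (y : N -> R) :
  (forall a, 0 <= x a) ->
  (forall i, i \in W -> \sum_(a | h a == i) x a = y i) ->
  E \subset D :|: [set a | h a \in W] ->
  \sum_(a in E) x a <= \sum_(a in D) x a + \sum_(i in W) y i.
Proof.
move=> x_ge0 degW /subsetP sED.
have -> : \sum_(i in W) y i = \sum_(a | h a \in W) x a.
  rewrite (partition_big h (mem W)) //=; apply: eq_bigr => i iW.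
  rewrite -degW //; apply: eq_bigl => a.
  by case: eqP => [->|]; rewrite ?iW ?andbF.
(* Extending all three sums by 0 to every arc allows an arc-by-arc comparison; an arc counted twice
   on the right does no harm, as [x] is nonnegative. *)
rewrite [\sum_(a in E) _]big_mkcond [\sum_(a in D) _]big_mkcond.
rewrite [\sum_(a | h a \in W) _]big_mkcond -big_split /=; apply: ler_sum => a _.
have := sED a; rewrite !inE.
case: (a \in E) => [/(_ isT)|_]; last by rewrite addr_ge0 //; case: ifP.
by case: (a \in D) => /= [_|->]; rewrite ?add0r // lerDl; case: ifP.
Qed.

(** [sigma] lies in [tau :&: V], hence is disjoint from [tau :\: V], and [y] is nonnegative. *)
Lemma weight_setD_le (R : realDomainType) (N : finType) (y : N -> R)
    (sigma tau V : {set N}) :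
  (forall i, 0 <= y i) -> sigma \subset tau -> sigma \subset V ->
  \sum_(i in sigma) y i + \sum_(i in tau :\: V) y i <= \sum_(i in tau) y i.
Proof.
move=> y_ge0 sst ssV; rewrite [leRHS](big_setID V) /= lerD2r.
have sI : sigma \subset tau :&: V by rewrite subsetI sst.
rewrite big_mkcond [leRHS]big_mkcond /=; apply: ler_sum => i _.
by case: ifP => [/(subsetP sI)->|_] //; case: ifP.
Qed.

Section Domination.
Context {R : realType} (I : stop_instance R).
Context (x : {ffun diarc I -> R}) (y : {ffun node I -> R}).
Context (f : {ffun diarc I -> R}) (phi : R) (Lx : in_polyhedron x y f phi).
Context (sigma tau : {set node I}).
Hypotheses (tau_st : tau \subset ~: [set source I; target I])
  (sub_tau : sigma \subset tau).

Lemma inner_node i : i \in tau -> i \in mandatory I :|: profit I.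
Proof.
move=> /(subsetP tau_st); rewrite in_setC => /negbTE ni.
by have := in_setT i; rewrite -(node_cover I) in_setU ni orbF.
Qed.

Lemma out_degree_in_clique i :
  i \in tau -> \sum_(a | src a == i) x a = y i.
Proof. by move=> /inner_node/(out_degree Lx). Qed.

Lemma in_degree_in_clique i :
  i \in tau -> \sum_(a | tgt a == i) x a = y i.
Proof.
move=> it; have /eqP := balance Lx (inner_node it).
by rewrite subr_eq0 out_degree_in_clique // => /eqP.
Qed.

(** Contrapositive form of the domination, for both directions at once: [D] stands for the cut of
    [V] and [E] for that of [V :|: tau]. The term [\sum_(i in tau :\: V) y i] is added to both sides
    and cancels. *)
Lemma cut_bound_setU (h : diarc I -> node I) (D E : {set diarc I})
    (V : {set node I}) :
  (forall i, i \in tau -> \sum_(a | h a == i) x a = y i) ->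
  E \subset D :|: [set a | h a \in tau :\: V] -> sigma \subset V ->
  \sum_(i in tau) y i <= \sum_(a in E) x a ->
  \sum_(i in sigma) y i <= \sum_(a in D) x a.
Proof.
move=> degh sED ssV le_tau.
have y_ge0 i : 0 <= y i by case/andP: (y_bounds Lx i).
have x_ge0 a : 0 <= x a by case/andP: (x_bounds Lx a).
rewrite -(lerD2r (\sum_(i in tau :\: V) y i)).
apply: le_trans (weight_setD_le y_ge0 sub_tau ssV) (le_trans le_tau _).
by apply: cut_sum_le sED => // i /setDP[/degh].
Qed.

Lemma ccc_domination : violates_ccc x y sigma -> violates_ccc x y tau.
Proof.
have tau_s : tau \subset ~: [set source I].
  by apply: subset_trans tau_st _; rewrite setCS subsetUl.
have tau_t : tau \subset ~: [set target I].
  by apply: subset_trans tau_st _; rewrite setCS subsetUr.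
(* The enlarged set is admissible because [tau] avoids both terminals. *)
case=> -[V [Vst sV viol]]; [left | right]; exists (V :|: tau);
  rewrite subUset Vst subsetUr; split=> // le_tau; apply: viol.
- apply: cut_bound_setU in_degree_in_clique _ sV le_tau.
  (* An arc entering [V :|: tau] has its tail outside [V], so it enters [V] unless its head lies in
     [tau :\: V]. *)
  apply/subsetP => a; rewrite !inE.
  by case: (src a \in V); case: (tgt a \in V); case: (tgt a \in tau);
     rewrite ?andbF.
- apply: cut_bound_setU out_degree_in_clique _ sV le_tau.
  (* Symmetrically, the head is outside [V], so the arc leaves [V] unless its tail lies in
     [tau :\: V]. *)
  apply/subsetP => a; rewrite !inE.
  by case: (src a \in V); case: (tgt a \in V); case: (src a \in tau);
     rewrite ?andbF.
Qed.

End Domination.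

Theorem theorem2 (R : realType) (I : stop_instance R)
    (sigma1 : {set node I}) :
  conflict_clique sigma1 ->
  ~ maximal_clique sigma1 ->
  exists sigma2 : {set node I},
    [/\ conflict_clique sigma2,
        sigma1 \proper sigma2 &
        forall (x : {ffun diarc I -> R}) (y : {ffun node I -> R})
               (f : {ffun diarc I -> R}) (phi : R),
          in_polyhedron x y f phi ->
          violates_ccc x y sigma1 ->
          violates_ccc x y sigma2].
Proof.
move=> clique1 nmax1.
have [tau [clique_tau lt_tau]] :
    exists tau, conflict_clique tau /\ sigma1 \proper tau.
  (* Non-maximality only denies that no larger clique exists; classical logic extracts one. *)
  by apply: contrapT => no_tau; apply: nmax1.
exists tau; split=> // x y f phi Lx.
by apply: (ccc_domination Lx); [case: clique_tau | apply: proper_sub].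
Qed.
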